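(* For every graph $G$ and every edge $e\in E(G)$, $\dfrac{\operatorname{bdim}(G-e)}{\operatorname{bdim}(G)}\le 3$.
   Context: All graphs are finite, simple and undirected. $d(u,v)$ is graph distance ($\infty$ if $u,v$ lie in different components), and for a positive integer $k$, $d_k(u,v)=\min\{d(u,v),k+1\}$. A function $f:V(G)\to\mathbb{Z}_{\ge0}$ is a resolving broadcast of $G$ if for any distinct $x,y\in V(G)$ there is $z$ with $f(z)>0$ and $d_{f(z)}(x,z)\ne d_{f(z)}(y,z)$; $\operatorname{bdim}(G)$ is the minimum of $\sum_v f(v)$ over resolving broadcasts $f$ of $G$. $G-e$ denotes $G$ with the edge $e$ removed. *)

(* Defs.v *)
From mathcomp Require Import all_boot.

Set Implicit Arguments.
Unset Strict Implicit.
Unset Printing Implicit Defensive.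

Record sgraph := SGraph {
  vertex :> finType;
  adj : rel vertex;
  adj_sym : symmetric adj;
  adj_irr : irreflexive adj
}.

(* Edges are unordered pairs, i.e. two-element sets of vertices. *)
Definition edges (G : sgraph) : {set {set G}} :=
  [set [set p.1; p.2] | p : G * G & adj p.1 p.2].

Definition del_adj (G : sgraph) (e : {set G}) : rel G :=
  fun x y => adj x y && ([set x; y] != e).

Lemma del_adj_sym (G : sgraph) (e : {set G}) : symmetric (del_adj e).
Proof. by move=> x y; rewrite /del_adj adj_sym setUC. Qed.

Lemma del_adj_irr (G : sgraph) (e : {set G}) : irreflexive (del_adj e).
Proof. by move=> x; rewrite /del_adj adj_irr. Qed.

Definition del_edge (G : sgraph) (e : {set G}) : sgraph :=
  SGraph (del_adj_sym e) (del_adj_irr e).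

Definition walk (G : sgraph) (n : nat) (u v : G) : bool :=
  [exists p : n.-tuple G, path (@adj G) u p && (last u p == v)].

Lemma connect_walk (G : sgraph) (u v : G) :
  connect (@adj G) u v -> exists n, walk n u v.
Proof.
case/connectP=> p up ->; exists (size p).
by apply/existsP; exists (in_tuple p); rewrite up eqxx.
Qed.

(* None stands for an infinite distance. *)
Definition dist (G : sgraph) (u v : G) : option nat :=
  if @idP (connect (@adj G) u v) is ReflectT uv
  then Some (ex_minn (connect_walk uv)) else None.

Definition tdist (G : sgraph) (k : nat) (u v : G) : nat :=
  if dist u v is Some d then minn d k.+1 else k.+1.

Definition resolving (G : sgraph) (f : G -> nat) : bool :=
  [forall x, forall y, (x != y) ==>
    [exists z, (0 < f z) && (tdist (f z) x z != tdist (f z) y z)]].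

Definition cost (G : sgraph) (f : G -> nat) : nat := \sum_v f v.

(* The values of a function of cost n are at most n, so restricting them to
   'I_n.+1 loses nothing and makes the existence decidable; see bdimP. *)
Definition has_resolving_cost (G : sgraph) (n : nat) : bool :=
  [exists f : {ffun G -> 'I_n.+1},
    resolving (fun v => f v : nat) && (cost (fun v => f v : nat) == n)].

Lemma eq_resolving (G : sgraph) (f g : G -> nat) :
  f =1 g -> resolving f = resolving g.
Proof.
move=> fg; apply: eq_forallb => x; apply: eq_forallb => y; congr (_ ==> _).
by apply: eq_existsb => z; rewrite fg.
Qed.

Lemma has_resolving_costP (G : sgraph) (n : nat) :
  reflect (exists2 f : G -> nat, resolving f & cost f = n)
          (has_resolving_cost G n).
Proof.
apply: (iffP existsP) => [[f /andP[rf /eqP cf]]|[f rf cf]].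
  by exists (fun v => f v : nat).
have lef v : f v < n.+1.
  by rewrite ltnS -cf /cost (bigD1 v) //= leq_addr.
exists [ffun v => Ordinal (lef v)].
have E : (fun v => [ffun v => Ordinal (lef v)] v : nat) =1 f.
  by move=> v; rewrite ffunE.
by rewrite (eq_resolving E) rf /cost (eq_bigr _ (fun v _ => E v)) -cf /=.
Qed.

Lemma dist_eq0 (G : sgraph) (u v : G) : (dist u v == Some 0) = (u == v).
Proof.
have w0 : walk 0 u v = (u == v).
  apply/existsP/idP => [[p]|uv]; first by rewrite tuple0.
  by exists [tuple].
rewrite /dist; case: {-}_ / idP => [uv|nuv].
  rewrite -w0; case: ex_minnP => m wm minm.
  apply/eqP/idP => [[<-] //|/minm]; by rewrite leqn0 => /eqP ->.
by apply/esym/negP => /eqP uv; apply: nuv; rewrite uv connect0.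
Qed.

Lemma tdist_eq0 (G : sgraph) (k : nat) (u v : G) :
  (tdist k u v == 0) = (u == v).
Proof. by rewrite -dist_eq0 /tdist; case: dist => [[|d]|] //; rewrite minnSS. Qed.

Lemma resolving1 (G : sgraph) : resolving (fun _ : G => 1).
Proof.
apply/forallP => x; apply/forallP => y; apply/implyP => nxy.
apply/existsP; exists x => /=; apply: contra nxy => /eqP xy.
by rewrite eq_sym -(tdist_eq0 1) -xy tdist_eq0.
Qed.

Lemma ex_resolving_cost (G : sgraph) : exists n, has_resolving_cost G n.
Proof.
exists (cost (fun _ : G => 1)); apply/has_resolving_costP.
by exists (fun=> 1) => //; apply: resolving1.
Qed.

Definition bdim (G : sgraph) : nat := ex_minn (ex_resolving_cost G).

Lemma bdimP (G : sgraph) :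
  (exists2 f : G -> nat, resolving f & cost f = bdim G) /\
  (forall f : G -> nat, resolving f -> bdim G <= cost f).
Proof.
rewrite /bdim; case: ex_minnP => m /has_resolving_costP rm minm.
by split=> // f rf; apply/minm/has_resolving_costP; exists f.
Qed.

(* In particular quotients by bdim G are genuine as soon as G has an edge. *)
Lemma bdim_gt0 (G : sgraph) (e : {set G}) : e \in edges G -> 0 < bdim G.
Proof.
case/imsetP=> -[x y]; rewrite inE /= => xy _; rewrite lt0n; apply/eqP => b0.
have [[f rf cf] _] := bdimP G.
have nxy : x != y by apply/eqP => E; rewrite E adj_irr in xy.
have /existsP[z /andP[fz _]] := implyP (forallP (forallP rf x) y) nxy.
by move: fz; apply/negP; rewrite -leqNgt -b0 -cf /cost (bigD1 z) //= leq_addr.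
Qed.

(* Main.v *)
(** Let [f] be an optimal resolving broadcast of [G] and [M] its maximum; raising
    [f] by [M] at both ends of [e] at most triples the cost.  The result resolves
    [G - e]: suppose [z] separates [x] from [y] in [G], with [x] the closer one.
    If a shortest walk from [x] to [z] survives in [G - e], then [z] still
    separates them, as distances only grow.  Otherwise that walk first meets [e]
    at some end [u]; the vertex [y] cannot be as close to [u] in [G - e] as [x]
    is, since following the rest of the walk would bring it as close to [z]. *)
Require Import Defs.
From mathcomp Require Import all_boot all_order all_algebra.
From mathcomp Require Import zify.

Set Implicit Arguments.
Unset Strict Implicit.
Unset Printing Implicit Defensive.

Lemma walkP (G : sgraph) n (x y : G) :
  reflect (exists p, [/\ size p = n, path (@adj G) x p & last x p = y])
          (walk n x y).
Proof.
apply: (iffP existsP) => [[p /andP[xp /eqP <-]]|[p [<- xp <-]]].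
  by exists p; rewrite size_tuple.
by exists (in_tuple p); rewrite xp eqxx.
Qed.

Lemma walk_connect (G : sgraph) n (x y : G) :
  walk n x y -> connect (@adj G) x y.
Proof. by case/walkP=> p [_ xp <-]; apply/connectP; exists p. Qed.

Lemma walk0 (G : sgraph) (x : G) : walk 0 x x.
Proof. by apply/walkP; exists [::]. Qed.

Lemma walk_cat (G : sgraph) m n (x y z : G) :
  walk m x y -> walk n y z -> walk (m + n) x z.
Proof.
move=> /walkP[p [<- xp <-]] /walkP[q [<- yq <-]]; apply/walkP; exists (p ++ q).
by rewrite size_cat cat_path xp last_cat.
Qed.

Lemma walk1 (G : sgraph) (x y : G) : adj x y -> walk 1 x y.
Proof. by move=> xy; apply/walkP; exists [:: y]; rewrite /= xy. Qed.

Lemma tdist_leS (G : sgraph) k (x y : G) : tdist k x y <= k.+1.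
Proof. by rewrite /tdist; case: dist => // d; apply: geq_minr. Qed.

(** Infinite and truncated distances both read [k.+1], above every threshold [n <= k], so up to [k]
    a bound on [tdist] amounts to the existence of a short walk. *)
Lemma tdist_leP (G : sgraph) n k (x y : G) : n <= k ->
  reflect (exists2 m, m <= n & walk m x y) (tdist k x y <= n).
Proof.
move=> le_nk; rewrite /tdist /dist; case: {-}_ / idP => [xy|nxy].
  case: ex_minnP => d wd mind; rewrite geq_min [k < n]ltnNge le_nk orbF.
  apply: (iffP idP) => [le_dn|[m le_mn /mind le_dm]]; first by exists d.
  exact: leq_trans le_mn.
rewrite ltnNge le_nk; apply: ReflectF => -[m _ /walk_connect].
exact: nxy.
Qed.

(** The smaller value is below [j.+1], hence a true distance that a larger radius leaves unchanged;
    a walk bringing [y] as close to [z] would already be seen at radius [j]. *)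
Lemma tdist_lt_widen (G : sgraph) j k (x y z : G) : j <= k ->
  tdist j x z < tdist j y z -> tdist k x z < tdist k y z.
Proof.
move=> le_jk lt_xy; have le_n : tdist j x z <= j.
  by rewrite -ltnS (leq_trans lt_xy) ?tdist_leS.
have /(tdist_leP _ _ le_n)[m le_mn wm] := leqnn (tdist j x z).
have le_nk := leq_trans le_n le_jk.
apply: (@leq_ltn_trans (tdist j x z)); first by apply/tdist_leP => //; exists m.
rewrite ltnNge; apply/negP => /(tdist_leP _ _ le_nk) w.
by move: lt_xy; rewrite ltnNge => /negP; apply; apply/tdist_leP.
Qed.

Section EdgeDeletion.
Variables (G : sgraph) (e : {set G}).
Local Notation H := (del_edge e).

Lemma walk_del_edge n (x y : G) : walk n (x : H) y -> walk n x y.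
Proof.
case/walkP=> p [sp xp lp]; apply/walkP; exists p; split=> //.
by apply: sub_path xp => a b /andP[].
Qed.

(** Induction on the walk, cut just before its first step along [e]; the remainder, of length [b],
    is a walk of [G] and may use [e] again. *)
Lemma walk_first_use n (x z : G) : walk n x z ->
  walk n (x : H) z \/
  exists a b u, [/\ u \in e, walk a (x : H) u, walk b u z & a + b = n].
Proof.
case/walkP=> p [<- xp <-] {n z}; elim: p x xp => [|y p IH] x /=.
  by left; apply: walk0.
case/andP=> xy yp; have [def_e | ne_e] := eqVneq [set x; y] e.
  right; exists 0, (size p).+1, x; split=> //; first by rewrite -def_e set21.
    exact: walk0.
  by apply/walkP; exists (y :: p); rewrite /= xy.
have xyH : @adj H x y by rewrite /= /del_adj xy ne_e.
have [w | [a [b [u [eu wa wb <-]]]]] := IH y yp.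
  by left; apply: (walk_cat (walk1 xyH) w).
by right; exists a.+1, b, u; split=> //; apply: (walk_cat (walk1 xyH) wa).
Qed.

Lemma tdist_lt_del_edge k (x y z : G) : tdist k x z < tdist k y z ->
  tdist k (x : H) z < tdist k (y : H) z \/
  exists2 u, u \in e & tdist k (x : H) u < tdist k (y : H) u.
Proof.
move=> lt_xy; have le_nk : tdist k x z <= k.
  by rewrite -ltnS (leq_trans lt_xy) ?tdist_leS.
have far m : m <= tdist k x z -> ~ walk m y z.
  move=> le_m wm; move: lt_xy; rewrite ltnNge => /negP; apply.
  by apply/(tdist_leP _ _ le_nk); exists m.
have /(tdist_leP _ _ le_nk)[n le_n /walk_first_use] := leqnn (tdist k x z).
case=> [w | [a [b [u [eu wa wb def_n]]]]].
  left; apply: (@leq_ltn_trans (tdist k x z)).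
    by apply/tdist_leP => //; exists n.
  rewrite ltnNge; apply/negP => /(tdist_leP _ _ le_nk)[m le_m].
  by move/walk_del_edge; apply: far.
right; exists u => //; have le_ak : a <= k by lia.
apply: (@leq_ltn_trans a); first by apply/tdist_leP => //; exists a.
rewrite ltnNge; apply/negP => /(tdist_leP _ _ le_ak)[m le_m] /walk_del_edge wm.
by apply: (far (m + b)) (walk_cat wm wb); lia.
Qed.

Lemma resolving_del_edge (f : G -> nat) : resolving f ->
  @resolving H (fun v => f v + (v \in e) * \max_w f w).
Proof.
move=> rf; set g := fun v => _.
(* Strict inequality fixes which vertex is closer; [!=] gives it up to swapping [x] and [y]. *)
suff sep (x y z : G) : 0 < f z -> tdist (f z) x z < tdist (f z) y z ->
    exists2 w : H, 0 < g w & tdist (g w) (x : H) w < tdist (g w) (y : H) w.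
  apply/forallP => x; apply/forallP => y; apply/implyP => nxy.
  have /existsP[z /andP[fz]] := implyP (forallP (forallP rf x) y) nxy.
  rewrite neq_ltn => /orP[] /(sep _ _ _ fz)[w gw lt_w];
    by apply/existsP; exists w; rewrite gw neq_ltn lt_w ?orbT.
move=> fz /tdist_lt_del_edge[lt_z | [u eu lt_u]].
  have le_fg : f z <= g z by apply: leq_addr.
  by exists z; [apply: leq_trans le_fg | apply: tdist_lt_widen lt_z].
(* Even if [f u] is 0, the added maximum makes the radius at [u] at least that of [z]. *)
have le_fg : f z <= g u.
  by rewrite /g eu mul1n (leq_trans _ (leq_addl _ _)) ?leq_bigmax.
by exists u; [apply: leq_trans le_fg | apply: tdist_lt_widen lt_u].
Qed.

Lemma bdim_del_edge : e \in edges G -> bdim H <= 3 * bdim G.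
Proof.
move=> he; have [[f rf <-] _] := bdimP G.
apply: leq_trans ((bdimP H).2 _ (resolving_del_edge rf)) _.
have le_e2 : #|e| <= 2.
  by case/imsetP: he => -[x y] _ ->; rewrite cards2; case: (_ != _).
have le_max : \max_w f w <= cost f.
  by apply/bigmax_leqP => v _; rewrite /cost (bigD1 v) //= leq_addr.
(* The factor 3 is [1 + 2]: the sum splits into [cost f] and [#|e|] copies of the maximum, each at
   most [cost f]. *)
rewrite /cost big_split /= -big_distrl /= -big_mkcond sum1_card mulSn leq_add2l.
exact: leq_mul.
Qed.

End EdgeDeletion.

Local Open Scope ring_scope.

Theorem theorem1p10 (G : sgraph) (e : {set G}) (he : e \in edges G) :
  (bdim (del_edge e))%:R / (bdim G)%:R <= 3 :> rat.
Proof.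
rewrite Num.Theory.ler_pdivrMr ?Num.Theory.ltr0n ?(bdim_gt0 he) //.
by rewrite -GRing.natrM Num.Theory.ler_nat bdim_del_edge.
Qed.
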